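(* Let $m,n\in\mathbb{N}$ with $m\le n$. For all $\mu\in \mathrm{M}_d(\mathbb{R}^m)$ and $\nu\in \mathrm{M}_{pd}(\mathbb{R}^n)$, $$\widehat{d}_{\mathrm{TV}}(\mu,\nu)\le\sqrt{\tfrac12\,\widehat{\mathrm{D}}_{\mathrm{KL}}(\mu\Vert\nu)}.$$
   Context: $\mathrm{M}(\mathbb{R}^n)$ is the set of Borel probability measures on $\mathbb{R}^n$; $\mathrm{M}_d(\mathbb{R}^n)$ is the set of those having a density with respect to Lebesgue measure, and $\mathrm{M}_{pd}(\mathbb{R}^n)$ the set of those having a strictly positive density. For $m\le n$, $\mathrm{O}(m,n)=\{V\in\mathbb{R}^{m\times n}: VV^{T}=I_m\}$. For $V\in \mathrm{O}(m,n)$, $b\in\mathbb{R}^m$, $\varphi_{V,b}:\mathbb{R}^n\to\mathbb{R}^m$ is $\varphi_{V,b}(x)=Vx+b$, and $\varphi_{V,b}(\mu)=\mu\circ\varphi_{V,b}^{-1}$ is the pushforward measure. For $\mu\in \mathrm{M}_d(\mathbb{R}^m)$ and $\nu\in \mathrm{M}_{pd}(\mathbb{R}^n)$, $$\Phi^-(\nu,m)=\{\beta\in \mathrm{M}(\mathbb{R}^m): \varphi_{V,b}(\nu)=\beta \text{ for some } V\in \mathrm{O}(m,n),\ b\in\mathbb{R}^m\},$$ $$\Phi^+_d(\mu,n)=\{\alpha\in \mathrm{M}_d(\mathbb{R}^n): \varphi_{V,b}(\alpha)=\mu \text{ for some } V\in \mathrm{O}(m,n),\ b\in\mathbb{R}^m\}.$$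 For measures on the same $\mathbb{R}^k$: $d_{\mathrm{TV}}(\mu,\nu)=\sup_A|\mu(A)-\nu(A)|$ over Borel sets $A$; and, for $\mu$ absolutely continuous with respect to $\nu$, $\mathrm{D}_{\mathrm{KL}}(\mu\Vert\nu)=\int\log\bigl(\tfrac{d\mu}{d\nu}\bigr)\,d\mu\in[0,\infty]$. The augmented distances are the common values $$\widehat{\mathrm{D}}_{\mathrm{KL}}(\mu\Vert\nu)=\inf_{\beta\in\Phi^-(\nu,m)} \mathrm{D}_{\mathrm{KL}}(\mu\Vert\beta)=\inf_{\alpha\in\Phi^+_d(\mu,n)} \mathrm{D}_{\mathrm{KL}}(\alpha\Vert\nu),$$ $$\widehat{d}_{\mathrm{TV}}(\mu,\nu)=\inf_{\beta\in\Phi^-(\nu,m)} d_{\mathrm{TV}}(\mu,\beta)=\inf_{\alpha\in\Phi^+_d(\mu,n)} d_{\mathrm{TV}}(\alpha,\nu).$$ (In each line the two infima are equal.) If $\widehat{\mathrm{D}}_{\mathrm{KL}}(\mu\Vert\nu)=\infty$ the right-hand side of the claim is read as $\infty$. *)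

(* Defs.v *)
From HB Require Import structures.
From mathcomp Require Import all_boot all_order all_algebra.
From mathcomp Require Import all_classical all_reals all_analysis.
From mathcomp Require Import lra.

Set Implicit Arguments.
Unset Strict Implicit.
Unset Printing Implicit Defensive.

Import Order.TTheory GRing.Theory Num.Theory.
Import numFieldNormedType.Exports.

Local Open Scope classical_set_scope.
Local Open Scope ring_scope.
Local Open Scope ereal_scope.

(* Column vectors with the Borel sigma-algebra, i.e. the one generated by the
   open sets of the topology of 'cV[R]_n. *)
Notation Rn R n := (g_sigma_algebraType (@open 'cV[R]_n)).

Section lebesgue_tuple.
Context {R : realType}.
Local Notation T := (measurableTypeR R).

Definition tuple_cons n (p : T * n.-tuple T) : n.+1.-tuple T :=
  [tuple of p.1 :: p.2].

Lemma measurable_tuple_cons n :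
  measurable_fun [set: T * n.-tuple T] (@tuple_cons n).
Proof. exact: measurable_cons. Qed.

Section cons.
Variables (n : nat) (mu : {sigma_finite_measure set (n.-tuple T) -> \bar R}).

Definition lebesgue_cons : set (n.+1.-tuple T) -> \bar R :=
  pushforward (@lebesgue_measure R \x mu) (@tuple_cons n).

Let lebesgue_cons0 : lebesgue_cons set0 = 0.
Proof. by rewrite /lebesgue_cons /pushforward preimage_set0 measure0. Qed.

Let lebesgue_cons_ge0 A : 0 <= lebesgue_cons A.
Proof. exact: (@measure_ge0 _ _ _ (@lebesgue_measure R \x mu)). Qed.

Let lebesgue_cons_sigma_additive : semi_sigma_additive lebesgue_cons.
Proof.
apply: measure_semi_sigma_additive; exact: measurable_tuple_cons.
Qed.

HB.instance Definition _ := isMeasure.Build _ _ _ lebesgue_cons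
  lebesgue_cons0 lebesgue_cons_ge0 lebesgue_cons_sigma_additive.

Lemma lebesgue_consE (A : set T) (B : set (n.-tuple T)) :
  measurable A -> measurable B ->
  lebesgue_cons [set t | A (thead t) /\ B [tuple of behead t]] =
  lebesgue_measure A * mu B.
Proof.
move=> mA mB.
rewrite -(product_measure1E (@lebesgue_measure R) mu mA mB).
congr (product_measure1 _ _ _).
apply/seteqP; split => -[x y]/=; rewrite theadE => -[Ax By]; split => //.
  by rewrite (_ : y = [tuple of behead (x :: y)])//; exact: val_inj.
by rewrite (_ : [tuple of _] = y)//; exact: val_inj.
Qed.

Let lebesgue_cons_sigma_finite : sigma_finite setT lebesgue_cons.
Proof.
have /sigma_finiteP[F [TF ndF Foo]] := sigma_finiteT (@lebesgue_measure R).
have /sigma_finiteP[G [TG ndG Goo]] := sigma_finiteT mu.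
exists (fun k => [set t : n.+1.-tuple T |
    F k (thead t) /\ G k [tuple of behead t]]).
  apply/esym; rewrite -subTset => t _.
  have [i _ Fi] : (\bigcup_i F i) (thead t) by rewrite -TF.
  have [j _ Gj] : (\bigcup_i G i) [tuple of behead t] by rewrite -TG.
  exists (maxn i j) => //; split.
    by move: Fi; exact/subsetPset/ndF/leq_maxl.
  by move: Gj; exact/subsetPset/ndG/leq_maxr.
move=> k; have [? ?] := Foo k; have [? ?] := Goo k; split.
  apply: measurableI; rewrite -[X in measurable X]setTI.
    exact: (@measurable_tnth _ T n.+1 ord0).
  exact: measurable_behead.
by rewrite lebesgue_consE// lte_mul_pinfty// ge0_fin_numE.
Qed.

HB.instance Definition _ := Measure_isSigmaFinite.Build _ _ _ lebesgue_cons
  lebesgue_cons_sigma_finite.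

End cons.

Fixpoint lebesgue_tuple n : {sigma_finite_measure set (n.-tuple T) -> \bar R} :=
  if n is k.+1 then lebesgue_cons (lebesgue_tuple k)
  else \d_([tuple] : 0.-tuple T).

End lebesgue_tuple.

Section lebesgue_Rn.
Context {R : realType} (n : nat).
Local Notation T := (measurableTypeR R).

Definition col_of_tuple (t : n.-tuple T) : Rn R n := \col_i tnth t i.

Lemma measurable_col_of_tuple : measurable_fun [set: n.-tuple T] col_of_tuple.
Proof.
apply: (@measurability _ _ (n.-tuple T) (Rn R n) _ _ (@open 'cV[R]_n)) => //.
move=> _ [U oU <-]; rewrite setTI.
pose r (k : nat) : R := (k.+1%:R^-1)%R.
pose box (p : {ffun 'I_n -> rat} * nat) : set (n.-tuple T) :=
  \bigcap_(i in [set: 'I_n])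
    [set t | tnth t i \in `](ratr (p.1 i) - r p.2)%R, (ratr (p.1 i) + r p.2)%R[].
have mbox p : measurable (box p).
  apply: fin_bigcap_measurable => // i _.
  rewrite -[X in measurable X]setTI.
  have := @measurable_tnth _ T n i.
  move=> /(_ measurableT `](ratr (p.1 i) - r p.2)%R, (ratr (p.1 i) + r p.2)%R[%classic).
  by apply; exact: measurable_itv.
rewrite (_ : _ @^-1` _ =
    \bigcup_p (box p `&` [set _ | box p `<=` col_of_tuple @^-1` U])).
  apply: countable_bigcupT_measurable => // p.
  have [pU|pU] := pselect (box p `<=` col_of_tuple @^-1` U).
    by rewrite (_ : mkset _ = setT) ?setIT//; apply/seteqP; split.
  by rewrite (_ : mkset _ = set0) ?setI0//; apply/seteqP; split.
apply/seteqP; split => [t tU|t [p _ [bt bU]]]; last exact: bU.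
have : nbhs (col_of_tuple t : 'cV[R]_n) U by apply: open_nbhs_nbhs.
move=> /nbhs_ballP[e/= e0 eU].
have [k ke] : exists k, (r k *+ 2 < e)%R.
  have e20 : (0 < e / 2)%R by rewrite divr_gt0.
  have [k _ /(_ k (leqnn k))/= ke] := near_infty_natSinv_lt (PosNum e20).
  by exists k; rewrite -mulr_natr -ltr_pdivlMr.
have r0 : (0 < r k)%R by rewrite invr_gt0.
have rq i : {q : rat | ratr q \in `](tnth t i - r k)%R, (tnth t i + r k)%R[}.
  by apply: cid; apply: rat_in_itvoo; rewrite ltrBlDr -addrA ltrDl addr_gt0.
pose q := [ffun i => sval (rq i)].
have tbox : box (q, k) t.
  move=> i _ /=; rewrite ffunE; have := svalP (rq i).
  by rewrite !in_itv/= => /andP[? ?]; apply/andP; split; lra.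
exists (q, k) => //; split => // s sbox; apply: eU; split => // i j.
rewrite /ball/= !mxE.
have := sbox i Logic.I; have := tbox i Logic.I.
rewrite /= !in_itv/= => /andP[? ?] /andP[? ?].
by rewrite ltr_norml; apply/andP; split; lra.
Qed.

(* The n-fold product of the one-dimensional Lebesgue measure, carried over from
   tuples to column vectors; lebesgue_Rn_box below gives its value on boxes. *)
Definition lebesgue_Rn : set (Rn R n) -> \bar R :=
  pushforward (lebesgue_tuple n) col_of_tuple.

Let lebesgue_Rn0 : lebesgue_Rn set0 = 0.
Proof. by rewrite /lebesgue_Rn /pushforward preimage_set0 measure0. Qed.

Let lebesgue_Rn_ge0 A : 0 <= lebesgue_Rn A.
Proof. exact: (@measure_ge0 _ _ _ (lebesgue_tuple n)). Qed.

Let lebesgue_Rn_sigma_additive : semi_sigma_additive lebesgue_Rn.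
Proof.
apply: measure_semi_sigma_additive; exact: measurable_col_of_tuple.
Qed.

HB.instance Definition _ := isMeasure.Build _ _ _ lebesgue_Rn
  lebesgue_Rn0 lebesgue_Rn_ge0 lebesgue_Rn_sigma_additive.

End lebesgue_Rn.
Arguments lebesgue_Rn {R} n.

Lemma lebesgue_tuple_box {R : realType} (n : nat)
    (A : 'I_n -> set (measurableTypeR R)) :
  (forall i, measurable (A i)) ->
  lebesgue_tuple n [set t | forall i, A i (tnth t i)] =
  \prod_(i < n) lebesgue_measure (A i).
Proof.
elim: n A => [A _|n IH A mA].
  rewrite big_ord0 /= (_ : mkset _ = setT) ?diracT//.
  by apply/seteqP; split => // t _ [].
rewrite big_ord_recl -IH// -lebesgue_consE//; last first.
  rewrite (_ : mkset _ = \bigcap_(i in [set: 'I_n])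
      ((fun t => tnth t i) @^-1` A (lift ord0 i))).
    apply: fin_bigcap_measurable => // i _; rewrite -[X in measurable X]setTI.
    exact: measurable_tnth.
  by apply/seteqP; split => [t At i _|t At i]; exact: At.
congr (lebesgue_cons _ _); apply/seteqP; split => t /=.
  move=> At; split=> [|i]; first exact: At.
  by rewrite tnth_behead (_ : inord _ = lift ord0 i)//;
    apply/val_inj; rewrite /= inordK// ltnS.
move=> [A0 AS] i; case: (unliftP ord0 i) => [j|] ->//.
by have := AS j; rewrite tnth_behead (_ : inord _ = lift ord0 j)//;
  apply/val_inj; rewrite /= inordK// ltnS.
Qed.

Lemma lebesgue_Rn_box {R : realType} (n : nat)
    (A : 'I_n -> set (measurableTypeR R)) :
  (forall i, measurable (A i)) ->
  lebesgue_Rn n [set x | forall i, A i (x i ord0)] =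
  \prod_(i < n) lebesgue_measure (A i).
Proof.
move=> mA; rewrite -lebesgue_tuple_box//; congr (lebesgue_tuple n _).
by apply/seteqP; split => t /= At i; have := At i; rewrite mxE.
Qed.

Section divergences.
Context d (T : measurableType d) (R : realType).
Implicit Types mu nu : probability T R.

Definition dTV mu nu : \bar R :=
  ereal_sup [set `|mu A - nu A| | A in measurable].

(* The value +oo outside the absolutely continuous case is the usual
   convention. *)
Definition dKL mu nu : \bar R :=
  if `[< mu `<< nu >] then
    \int[mu]_x lne (Radon_Nikodym (charge_of_finite_measure mu) nu x)
  else +oo.

End divergences.

Section augmented.
Context {R : realType}.

Definition has_density n (mu : probability (Rn R n) R) (f : Rn R n -> R) :=
  [/\ measurable_fun [set: Rn R n] f, (forall x, 0 <= f x)%R &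
      forall A : set (Rn R n), measurable A ->
        mu A = \int[lebesgue_Rn n]_(x in A) (f x)%:E].

Definition M_d n : set (probability (Rn R n) R) :=
  [set mu | exists f, has_density mu f].

Definition M_pd n : set (probability (Rn R n) R) :=
  [set mu | exists2 f, has_density mu f & forall x, (0 < f x)%R].

Definition stiefel m n : set 'M[R]_(m, n) := [set V | (V *m V^T = 1%:M)%R].

Definition affine_map m n (V : 'M[R]_(m, n)) (b : 'cV[R]_m)
  (x : Rn R n) : Rn R m := (V *m x + b)%R.

(* phi_{V,b}(mu) = nu as Borel measures; set functions also take junk values on
   non-measurable sets, where they need not agree. *)
Definition affine_image m n (V : 'M[R]_(m, n)) (b : 'cV[R]_m)
    (mu : probability (Rn R n) R) (nu : probability (Rn R m) R) :=
  forall A, measurable A -> pushforward mu (affine_map V b) A = nu A.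

Definition Phi_minus n (nu : probability (Rn R n) R) m :
    set (probability (Rn R m) R) :=
  [set beta | exists V b, @stiefel m n V /\ affine_image V b nu beta].
Arguments Phi_minus {n} nu m.

Definition Phi_plus_d m (mu : probability (Rn R m) R) n :
    set (probability (Rn R n) R) :=
  [set alpha | M_d alpha /\
    exists V b, @stiefel m n V /\ affine_image V b alpha mu].
Arguments Phi_plus_d {m} mu n.

(* Each augmented distance has two descriptions with the same value: the infimum
   over Phi_minus and the infimum over Phi_plus_d. *)
Variables (m n : nat) (mu : probability (Rn R m) R)
  (nu : probability (Rn R n) R).

Definition dKL_minus := ereal_inf [set dKL mu beta | beta in Phi_minus nu m].
Definition dKL_plus := ereal_inf [set dKL alpha nu | alpha in Phi_plus_d mu n].
Definition dTV_minus := ereal_inf [set dTV mu beta | beta in Phi_minus nu m].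
Definition dTV_plus := ereal_inf [set dTV alpha nu | alpha in Phi_plus_d mu n].

End augmented.

(* Main.v *)
Require Import Defs.
From mathcomp Require Import all_boot all_order all_algebra.
From mathcomp Require Import all_classical all_reals all_analysis.
From mathcomp Require Import measurable_realfun.
From mathcomp Require Import ring lra.

Set Implicit Arguments.
Unset Strict Implicit.
Unset Printing Implicit Defensive.

Import Order.TTheory GRing.Theory Num.Theory.
Import numFieldNormedType.Exports.

(** Both claims reduce to Pinsker's inequality [dTV mu nu <= sqrt (dKL mu nu / 2)]
    for arbitrary probability measures, since the square root is monotone and
    continuous.  Pinsker's inequality comes from the variational bound
    [int g dmu <= dKL mu nu], valid as soon as [int e^g dnu <= 1], applied to
    [g = s 1_A - (q s + s^2/8)] with [p = mu A], [q = nu A] and [s = 4 (p - q)].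
    Its hypothesis is Hoeffding's bound on the Bernoulli moment generating
    function, and [int g dmu = s (p - q) - s^2/8 = 2 (p - q)^2]. *)

Local Open Scope classical_set_scope.
Local Open Scope ring_scope.
Local Open Scope ereal_scope.

Lemma is_derive_ge0_le {R : realType} (f df : R -> R) (s : R) : (0 <= s)%R ->
  (forall x : R, is_derive x 1%R f (df x)) ->
  (forall x, (0 <= x)%R -> (0 <= df x)%R) ->
  (f 0 <= f s)%R.
Proof.
move=> s0 fd df0.
have [|c] := @MVT_segment R f df 0%R s s0 (fun x _ => fd x).
  apply: continuous_subspaceT => x; apply: differentiable_continuous.
  by apply/derivable1_diffP; apply: ex_derive; exact: fd.
rewrite in_itv/= => /andP[c0 _] E; rewrite -subr_ge0 E subr0 mulr_ge0// df0//.
Qed.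

(** In logarithmic form this is a second-order Taylor bound at 0: [ln z] has value 0 and slope [q]
    there, its derivative is the tilted success probability [u], and [u' = u (1 - u)] is a Bernoulli
    variance. *)
Lemma bernoulli_mgf_le {R : realType} (q s : R) :
  (0 <= q <= 1)%R -> (0 <= s)%R ->
  (1 - q + q * expR s <= expR (q * s + s ^+ 2 / 8))%R.
Proof.
move=> /andP[q0 q1] s0.
pose z (t : R) := (1 - q + q * expR t)%R.
have z0 t : (0 < z t)%R.
  rewrite /z; have [->|q0'] := eqVneq q 0%R; first by rewrite mul0r; lra.
  have : (0 < q * expR t)%R by rewrite mulr_gt0 ?expR_gt0// lt_neqAle eq_sym q0'.
  by move=> ?; lra.
have zd (t : R) : is_derive t 1%R z (q * expR t)%R.
  rewrite /z; apply: is_derive_eq; rewrite /GRing.scale/=. ring.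
pose u (t : R) := (q * expR t / z t)%R.
have ud (t : R) : is_derive t 1%R u (u t * (1 - u t))%R.
  have zt0 : (z t != 0)%R by rewrite gt_eqF.
  rewrite /u; apply: is_derive_eq.
  rewrite /GRing.scale/=. field. exact: zt0.
(* [F] is convex with [F 0 = F' 0 = 0]; [F1] is [F'] and [u (1 - u) <= 1/4]. *)
pose F1 (t : R) := (q + t / 4 - u t)%R.
have F1d (t : R) : is_derive t 1%R F1 (1/4 - u t * (1 - u t))%R.
  rewrite /F1; apply: is_derive_eq; rewrite /GRing.scale/=. by field.
have F10 (t : R) : (0 <= t)%R -> (0 <= F1 t)%R.
  move=> t0; have -> : 0%R = F1 0%R.
    rewrite /F1 /u /z expR0; field; rewrite subrK; exact: oner_neq0.
  apply: (is_derive_ge0_le t0 F1d) => x _.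
  have -> : (1 / 4 - u x * (1 - u x) = (u x - 1/2)^+2)%R by field.
  exact: sqr_ge0.
pose F (t : R) := (q * t + t ^+ 2 / 8 - ln (z t))%R.
have Fd (t : R) : is_derive t 1%R F (F1 t).
  have zt0 : (z t != 0)%R by rewrite gt_eqF.
  have lnd := @is_derive1_comp _ _ _ t _ _ (is_derive1_ln (z0 t)) (zd t).
  rewrite /F; apply: is_derive_eq.
  rewrite /F1 /u /GRing.scale/=. field; exact: zt0.
have : (F 0 <= F s)%R := is_derive_ge0_le s0 Fd F10.
rewrite /F {1}/z expR0 mulr0 expr0n/= mul0r addr0 mulr1 subrK ln1 subr0.
by rewrite subr_ge0 -ler_expR lnK ?posrE ?z0.
Qed.

Section pinsker.
Context d (T : measurableType d) (R : realType).
Implicit Types mu nu : probability T R.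

(** Serves to compare with the logarithm of a density, whose integral may be [+oo]; positive and
    negative parts are therefore compared separately. *)
Lemma ae_integrable_le_integral (m : {measure set T -> \bar R})
    (f g : T -> \bar R) :
  m.-integrable [set: T] f -> measurable_fun [set: T] g ->
  {ae m, forall x, f x <= g x} -> \int[m]_x f x <= \int[m]_x g x.
Proof.
move=> fi mg fg; have mf := measurable_int _ fi.
rewrite integralE [leRHS]integralE leeB//.
  apply: ae_ge0_le_integral => //; [exact: measurable_funepos..|].
  apply: filterS fg => x fgx _.
  (* The bound is known only at this [x], so monotonicity is used on the singleton [[set x]]. *)
  by apply: (@funepos_le _ _ [set x] f g); rewrite ?inE// => y; rewrite inE => ->.
apply: ae_ge0_le_integral => //; [exact: measurable_funeneg..|].
apply: filterS fg => x fgx _.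
by apply: (@funeneg_le _ _ [set x] f g); rewrite ?inE// => y; rewrite inE => ->.
Qed.

(** With [r] the density and [e = e^g / r], the tangent-line bound on the exponential is integrated
    against [mu]; the factor [r] cancels in [e], which leaves at most the [nu]-integral of [e^g]. *)
Lemma integral_le_dKL mu nu (g : T -> R) : mu `<< nu ->
  mu.-integrable [set: T] (EFin \o g) ->
  \int[nu]_x (expR (g x))%:E <= 1 ->
  \int[mu]_x (g x)%:E <= dKL mu nu.
Proof.
move=> munu gi eg1; rewrite /dKL asboolT//.
set h := Radon_Nikodym _ _.
have hfin x : h x \is a fin_num by exact: Radon_Nikodym_fin_num.
have mh : measurable_fun [set: T] h.
  by apply: (@measurable_int _ _ _ nu); exact: Radon_Nikodym_integrable.
pose r x := fine (h x).
have hE x : h x = (r x)%:E by rewrite fineK.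
have mr : measurable_fun [set: T] r by exact: measurableT_comp.
have mg : measurable_fun [set: T] g by exact/measurable_EFinP/(measurable_int _ gi).
have mpos : measurable_fun [set: T] (fun x => (0 < r x)%R).
  exact: measurable_fun_ltr.
(* On [0 < r], [1 + t <= e^t] at [t = g - ln r] is [g + (1 - e) <= ln r]. *)
pose e x : R := if (0 < r x)%R then expR (g x - ln (r x)) else 0%R.
have e0 x : (0 <= e x)%R by rewrite /e; case: ifP => // _; exact: expR_ge0.
have me : measurable_fun [set: T] e.
  apply: measurable_fun_ifT => //; apply: measurableT_comp => //.
  by apply: measurable_funB => //; exact: measurableT_comp.
have mle : measurable_fun [set: T] (fun x => lne (h x)).
  rewrite (_ : (fun x => _) =
      fun x => if (0 < r x)%R then (ln (r x))%:E else -oo); last first.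
    apply/funext => x; rewrite hE; case: ltP => r0; first by rewrite lne_EFin.
    by rewrite le0_lneNy.
  apply: measurable_fun_ifT => //.
  by apply/measurable_EFinP; exact: measurableT_comp.
have mneg : measurable [set x | ~~ (0 < r x)%R].
  rewrite -[X in measurable X]setTI.
  rewrite (_ : [set x | _] = (fun x => (0 < r x)%R) @^-1` [set false]).
    exact: mpos.
  by apply/seteqP; split => x /=; case: (0 < r x)%R.
(* The exceptional set has as [mu]-measure the [nu]-integral of [h] over it, where [h <= 0]. *)
have ae_pos : {ae mu, forall x, (0 < r x)%R}.
  exists [set x | ~~ (0 < r x)%R]; split => //; last by move=> x /= /negP.
  apply/eqP; rewrite eq_le measure_ge0 andbT.
  rewrite [leLHS](@Radon_Nikodym_integral _ _ _
    (charge_of_finite_measure mu) nu)// -/h.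
  rewrite -[leRHS](@integral0 _ _ _ nu [set x | ~~ (0 < r x)%R]).
  apply: le_integral => //.
    apply: (integrableS measurableT) => //; exact: Radon_Nikodym_integrable.
    exact: integrable0.
  by move=> x; rewrite inE/= -leNgt hE lee_fin.
have ie : \int[mu]_x (e x)%:E <= 1.
  rewrite -(Radon_Nikodym_SigmaFinite.change_of_variables munu)//; last first.
    exact/measurable_EFinP.
  apply: le_trans eg1; apply: ae_ge0_le_integral => //.
  - by move=> x _; rewrite mule_ge0 ?lee_fin// Radon_Nikodym_SigmaFinite.f_ge0.
  - apply: emeasurable_funM; first exact/measurable_EFinP.
    apply: (@measurable_int _ _ _ nu).
    exact: Radon_Nikodym_SigmaFinite.f_integrable.
  - by apply/measurable_EFinP; exact: measurableT_comp.
  (* The change of variables uses another version of the density, equal to [h] only [nu]-almost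
     everywhere. Where [r <= 0], the default [e = 0] keeps the product below [e^g]. *)
  apply: filterS (ae_eq_Radon_Nikodym_SigmaFinite munu measurableT).
  move=> x /(_ Logic.I) -> _; rewrite -/h hE -EFinM lee_fin /e.
  case: ifPn => r0; last by rewrite mul0r expR_ge0.
  by rewrite expRD expRN lnK// divfK// gt_eqF.
have iie : mu.-integrable [set: T] (EFin \o e).
  apply/integrableP; split; first exact/measurable_EFinP.
  under eq_integral do rewrite /= ger0_norm//.
  exact: le_lt_trans ie (ltry _).
have i1 : mu.-integrable [set: T] (EFin \o cst 1%R).
  exact: finite_measure_integrable_cst.
(* Adding [1 - e] does not lower the integral, by [ie]. *)
apply: (@le_trans _ _
  (\int[mu]_x ((EFin \o g) \+ ((EFin \o cst 1%R) \- (EFin \o e))) x)).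
  rewrite integralD//; last exact: integrableB.
  rewrite integralB// (_ : \int[mu]_x (EFin \o cst 1%R) x = 1); last first.
    rewrite -[LHS]/(\int[mu]_x (cst 1%E x)) integral_cst//.
    by rewrite mul1e; exact: probability_setT.
  by rewrite leeDl// sube_ge0// orbC.
apply: ae_integrable_le_integral => //.
  by apply: integrableD => //; exact: integrableB.
apply: filterS ae_pos => x rx /=.
rewrite hE lne_EFin// -!EFinB -EFinD lee_fin /e rx.
have := expR_ge1Dx (g x - ln (r x)); lra.
Qed.

(** Used for [g] under [mu] and for [e^g] under [nu]: any function of an indicator is affine in
    it. *)
Lemma integral_affine_indic (P : probability T R) (A : set T) (a b : R) :
  measurable A ->
  P.-integrable [set: T] (EFin \o (fun x => a * \1_A x + b)%R) /\
  \int[P]_x (a * \1_A x + b)%:E = (a * fine (P A) + b)%:E.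
Proof.
move=> mA.
have i1 : P.-integrable [set: T] (fun x => a%:E * (\1_A x)%:E).
  by apply: integrableZl => //; exact: integrable_indic.
have i2 : P.-integrable [set: T] (EFin \o cst b).
  exact: finite_measure_integrable_cst.
have i2E : \int[P]_x (EFin \o cst b) x = b%:E.
  rewrite -[LHS]/(\int[P]_x (cst b%:E x)) integral_cst//.
  by rewrite -[RHS]mule1; congr (_ * _); exact: probability_setT.
split; first exact: (integrableD _ i1 i2).
rewrite -[LHS]/(\int[P]_x (a%:E * (\1_A x)%:E + (EFin \o cst b) x)).
rewrite integralD// integralZl//; last exact: integrable_indic.
rewrite integral_indic// setIT i2E.
by rewrite EFinD EFinM fineK// fin_num_measure.
Qed.

Lemma sqr_measure_diff_le_dKL_ordered mu nu (A : set T) :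
  mu `<< nu -> measurable A ->
  (fine (nu A) <= fine (mu A))%R ->
  (2 * (fine (mu A) - fine (nu A)) ^+ 2)%:E <= dKL mu nu.
Proof.
move=> munu mA; set p := fine (mu A); set q := fine (nu A) => qp.
have q01 : (0 <= q <= 1)%R.
  rewrite -!lee_fin fineK ?fin_num_measure// measure_ge0/=.
  exact: probability_le1.
pose s := (4 * (p - q))%R; pose K := (q * s + s ^+ 2 / 8)%R.
have [gi gE] := integral_affine_indic mu s (- K) mA.
suff : \int[mu]_x (s * \1_A x - K)%:E <= dKL mu nu.
  by apply: le_trans; rewrite gE -/p /K /s lee_fin; lra.
apply: integral_le_dKL => //.
rewrite (_ : (fun x => _) = fun x : T =>
    (expR (- K) * (expR s - 1) * \1_A x + expR (- K))%:E); last first.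
  apply/funext => x; congr EFin; rewrite expRD indicE; case: (x \in A).
    by rewrite mulr1/=; ring.
  by rewrite mulr0/= expR0; ring.
have [_ ->] :=
  integral_affine_indic nu (expR (- K) * (expR s - 1)) (expR (- K)) mA.
rewrite -/q lee_fin.
have -> : (expR (- K) * (expR s - 1) * q + expR (- K) =
  expR (- K) * (1 - q + q * expR s))%R by ring.
rewrite expRN mulrC ler_pdivrMr ?expR_gt0// mul1r.
by apply: bernoulli_mgf_le => //; rewrite /s; lra.
Qed.

(** Passing to the complement flips the sign of the difference, so the ordering may be assumed. *)
Lemma sqr_measure_diff_le_dKL mu nu (A : set T) : measurable A ->
  (2 * (fine (mu A) - fine (nu A)) ^+ 2)%:E <= dKL mu nu.
Proof.
move=> mA; have [munu|nmunu] := pselect (mu `<< nu); last first.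
  by rewrite /dKL asboolF// leey.
have [qp|/ltW pq] := leP (fine (nu A)) (fine (mu A)).
  exact: sqr_measure_diff_le_dKL_ordered.
have CE (P : probability T R) : fine (P (~` A)) = (1 - fine (P A))%R.
  by rewrite probability_setC// fineB// fin_num_measure.
have := sqr_measure_diff_le_dKL_ordered munu (measurableC mA).
rewrite !CE (_ : 1 - _ - _ = - (fine (mu A) - fine (nu A)))%R; last by ring.
by rewrite sqrrN; apply; lra.
Qed.

Lemma dKL_ge0 mu nu : 0 <= dKL mu nu.
Proof.
have := sqr_measure_diff_le_dKL mu nu measurable0.
by rewrite !measure0/= subrr expr0n mulr0.
Qed.

Lemma dTV_ge0 mu nu : 0 <= dTV mu nu.
Proof.
apply: le_trans (abse_ge0 (mu set0 - nu set0)) _.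
by apply: ereal_sup_ubound; exists set0.
Qed.

Lemma pinsker mu nu : dTV mu nu <= sqrte ((2^-1)%:E * dKL mu nu).
Proof.
apply: ge_ereal_sup => _ [A mA <-].
rewrite -sqrte_sqr lee_sqrt; last by rewrite mule_ge0// dKL_ge0.
rewrite lee_pdivlMl//; apply: le_trans (sqr_measure_diff_le_dKL mu nu mA).
by rewrite -[mu A]fineK ?fin_num_measure// -[nu A]fineK ?fin_num_measure.
Qed.
End pinsker.

(** Squaring replaces a continuity argument: the square of the infimum of [f], divided by [c], is a
    lower bound for every [g i]. Empty [S] is covered too. *)
Lemma ereal_inf_le_sqrte {R : realType} I (S : set I) (f g : I -> \bar R)
    (c : R) :
  (0 < c)%R -> (forall i, S i -> 0 <= f i) -> (forall i, S i -> 0 <= g i) ->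
  (forall i, S i -> f i <= sqrte (c%:E * g i)) ->
  ereal_inf (f @` S) <= sqrte (c%:E * ereal_inf (g @` S)).
Proof.
move=> c0 f0 g0 fg.
have x0 : 0 <= ereal_inf (f @` S).
  by apply: le_ereal_inf_tmp => _ [i Si <-]; exact: f0.
rewrite -[leLHS]gee0_abs// -sqrte_sqr lee_sqrt; last first.
  rewrite mule_ge0 ?lee_fin ?(ltW c0)//.
  by apply: le_ereal_inf_tmp => _ [i Si <-]; exact: g0.
rewrite -lee_pdivrMl//; apply: le_ereal_inf_tmp => _ [i Si <-].
rewrite lee_pdivrMl// -lee_sqrt ?mule_ge0 ?lee_fin ?(ltW c0) ?g0//.
rewrite sqrte_sqr gee0_abs//; apply: le_trans (fg i Si).
by apply: ereal_inf_lbound; exists i.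
Qed.

Theorem mainTheorem5 (R : realType) (m n : nat) (hmn : (m <= n)%N)
    (mu : probability (Rn R m) R) (nu : probability (Rn R n) R)
    (hmu : M_d mu) (hnu : M_pd nu) :
  dTV_minus mu nu <= sqrte ((2^-1)%:E * dKL_minus mu nu) /\
  dTV_plus mu nu <= sqrte ((2^-1)%:E * dKL_plus mu nu).
Proof.
(* In each conjunct both infima run over the same family, so Pinsker applies member by member. *)
by split; apply: ereal_inf_le_sqrte => // *; rewrite ?dTV_ge0 ?dKL_ge0 ?pinsker.
Qed.
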